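(* Let $V$ be a weak quantum vertex algebra with a constant $\mathcal{S}$-map and let $n\in\mathbb{N}$. For $u,v\in V$ set $$u\tilde{*}_nv=\mathrm{Res}_x\sum_{i=0}^n\binom{-n-1}{i}\frac{e^{(n+1)x}}{(e^x-1)^{i+n+1}}Y(u,x)v,\qquad u\tilde{\circ}_nv=\mathrm{Res}_x\frac{e^{(n+1)x}}{(e^x-1)^{2n+2}}Y(u,x)v,$$ and let $\widetilde{O}_n(V)$ be the subspace of $V$ linearly spanned by $\mathcal{D}V$ and by the vectors $u\tilde{\circ}_nv$ for $u,v\in V$. Then $\widetilde{O}_n(V)$ is a two-sided ideal of the non-associative algebra $(V,\tilde{*}_n)$, and the quotient $\widetilde{A}_n(V)=V/\widetilde{O}_n(V)$ is an associative algebra.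
   Context: All vector spaces are over $\mathbb{C}$; $\mathbb{N}=\{0,1,2,\dots\}$; $\delta(x)=\sum_{n\in\mathbb{Z}}x^n$; binomial expressions are expanded in nonnegative powers of the second variable; $1/(e^x-1)^k$ is the inverse of $(e^x-1)^k$ in $\mathbb{C}((x))$. A weak quantum vertex algebra with a constant $\mathcal{S}$-map is a vector space $V$ with a linear map $Y(\cdot,x):V\to \mathrm{Hom}(V,V((x)))$, $Y(v,x)=\sum_{n\in\mathbb{Z}}v_nx^{-n-1}$, and a vector $\mathbf{1}\in V$ such that $Y(\mathbf{1},x)v=v$, $Y(v,x)\mathbf{1}\in V[[x]]$, $\lim_{x\to0}Y(v,x)\mathbf{1}=v$ for $v\in V$, and for any $u,v\in V$ there exist finitely many $u^{(i)},v^{(i)}\in V$ $(1\le i\le r)$ with $$x_0^{-1}\delta\left(\tfrac{x_1-x_2}{x_0}\right)Y(u,x_1)Y(v,x_2)-x_0^{-1}\delta\left(\tfrac{x_2-x_1}{-x_0}\right)\sum_{i=1}^{r}Y(v^{(i)},x_2)Y(u^{(i)},x_1)=x_2^{-1}\delta\left(\tfrac{x_1-x_0}{x_2}\right)Y(Y(u,x_0)v,x_2).$$ The operator $\mathcal{D}$ on $V$ is $\mathcal{D}v=v_{-2}\mathbf{1}$. *)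

(* Defs.v *)
From HB Require Import structures.
From mathcomp Require Import all_boot all_order all_algebra.
From mathcomp Require Import sesquilinear generic_quotient ring_quotient.
From mathcomp Require Import boolp classical_sets functions cardinality fsbigop reals.
From mathcomp Require Export complex.

Set Implicit Arguments.
Unset Strict Implicit.
Unset Printing Implicit Defensive.

Import GRing.Theory.
Local Open Scope classical_set_scope.
Local Open Scope quotient_scope.
Local Open Scope ring_scope.

(* A formal series in x is the function sending an exponent to its coefficient;
   it is indexed by [int], or by [int * int * int] for a series in the three
   variables (x0, x1, x2), exponents being listed in this order. *)
Section FormalSeries.
Variable F : fieldType.

(* Cauchy product.  The sum ranges over a finite support in every use below;
   [\sum_(i \in _)] is 0 by convention otherwise. *)
Definition fmul (I : zmodType) (V : lmodType F) (f : I -> F) (g : I -> V) :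
    I -> V :=
  fun n => \sum_(i \in [set: I]) f (n - i) *: g i.

Definition is_laurent (V : zmodType) (g : int -> V) : Prop :=
  exists N : int, forall k, k < N -> g k = 0.

Definition Res (V : zmodType) (g : int -> V) : V := g (-1).

Definition lmul (f g : int -> F) : int -> F := fmul f (g : int -> F^o).

Definition lone : int -> F := fun k => (k == 0)%:R.

Definition lpow (f : int -> F) (k : nat) : int -> F := iter k (lmul f) lone.

(* The inverse of f in the field of Laurent series (0 if f is not invertible). *)
Definition linv (f : int -> F) : int -> F :=
  xget (fun=> 0) [set g : int -> F | is_laurent g /\ lmul f g = lone].

(* e^(a x) *)
Definition lexp (a : F) : int -> F :=
  fun k => if k is Posz m then a ^+ m / m`!%:R else 0.

Definition gbinom (a : F) (k : nat) : F :=
  (\prod_(j < k) (a - j%:R)) / k`!%:R.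

(* Coefficient of x^p y^q in (x - y)^n, expanded in nonnegative powers of y. *)
Definition subexp (n p q : int) : F :=
  if q is Posz k then (if p + q == n then (-1) ^+ k * gbinom n%:~R k else 0)
  else 0.

(* As delta(z) is the sum of all z^n, the coefficient of x0^a in
   x0^-1 delta((x1 - x2) / x0) is (x1 - x2)^n with n = - a - 1; similarly for
   the other two. *)

(* x0^-1 delta((x1 - x2) / x0) *)
Definition delta12 : int * int * int -> F :=
  fun '(a, b, c) => subexp (- a - 1) b c.

(* x0^-1 delta((x2 - x1) / - x0) *)
Definition delta21 : int * int * int -> F :=
  fun '(a, b, c) => (-1) ^ (- a - 1) * subexp (- a - 1) c b.

(* x2^-1 delta((x1 - x0) / x2) *)
Definition delta10 : int * int * int -> F :=
  fun '(a, b, c) => subexp (- c - 1) b a.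

End FormalSeries.

Section WeakQVA.
Variables (F : fieldType) (V : lmodType F).

(* For Y(u, x) w = \sum_k (Y u w k) x^k: *)

(* Y(u, x1) Y(v, x2) w *)
Definition prod12 (Y : V -> V -> int -> V) (u v w : V) : int * int * int -> V :=
  fun '(a, b, c) => if a == 0 then Y u (Y v w c) b else 0.

(* Y(v, x2) Y(u, x1) w *)
Definition prod21 (Y : V -> V -> int -> V) (v u w : V) : int * int * int -> V :=
  fun '(a, b, c) => if a == 0 then Y v (Y u w b) c else 0.

(* Y(Y(u, x0) v, x2) w *)
Definition iter02 (Y : V -> V -> int -> V) (u v w : V) : int * int * int -> V :=
  fun '(a, b, c) => if b == 0 then Y (Y u v a) w c else 0.

(* Weak quantum vertex algebra structure on V with a constant S-map.  The list
   [s] consists of the pairs (u^(i), v^(i)). *)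
Record weakQVA := WeakQVA {
  vop : {bilinear V -> V -> (int -> V)};
  vac : V;
  vop_laurent : forall u v, is_laurent (vop u v);
  vop_vacl : forall v, vop vac v = fun k => if k == 0 then v else 0;
  vop_vacr : forall v k, k < 0 -> vop v vac k = 0;
  vop_creation : forall v, vop v vac 0 = v;
  vop_jacobi : forall u v, exists s : seq (V * V), forall w,
    fmul (@delta12 F) (prod12 vop u v w)
    - fmul (@delta21 F) (\sum_(p <- s) prod21 vop p.2 p.1 w)
    = fmul (@delta10 F) (iter02 vop u v w)
}.

Variable X : weakQVA.

(* The mode v_n, the coefficient of x^(-n-1) in Y(v, x). *)
Definition mode (v : V) (n : int) (w : V) : V := vop X v w (- n - 1).

Definition Dop (v : V) : V := mode v (- 2) (vac X).

(* e^((n+1) x) / (e^x - 1)^k *)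
Definition kern (n k : nat) : int -> F :=
  lmul (lexp n.+1%:R) (linv (lpow (lexp 1 - lone F) k)).

Definition star (n : nat) (u v : V) : V :=
  Res (\sum_(i < n.+1)
    gbinom (- n.+1%:R : F) i *: fmul (kern n (i + n + 1)%N) (vop X u v)).

Definition circ (n : nat) (u v : V) : V :=
  Res (fmul (kern n (2 * n + 2)%N) (vop X u v)).

End WeakQVA.

Section Span.
Variables (F : fieldType) (V : lmodType F).

Definition lspan (A : set V) : {pred V} :=
  fun v => `[< exists s : seq (F * V),
    (forall p, p \in s -> A p.2) /\ v = \sum_(p <- s) p.1 *: p.2 >].

Lemma lspan_submod_closed (A : set V) : submod_closed (lspan A).
Proof.
split=> [|a u v /asboolP[s [sA ->]] /asboolP[t [tA ->]]]; apply/asboolP.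
  by exists [::]; rewrite big_nil.
exists ([seq (a * p.1, p.2) | p <- s] ++ t); split.
  by move=> p; rewrite mem_cat => /orP[/mapP[q /sA Aq ->]|/tA].
rewrite big_cat big_map scaler_sumr; congr (_ + _).
by apply: eq_bigr => p _; rewrite scalerA.
Qed.

HB.instance Definition _ (A : set V) :=
  GRing.isSubmodClosed.Build F V (lspan A) (lspan_submod_closed A).

Definition two_sided_ideal (mul : V -> V -> V) (S : {pred V}) : Prop :=
  submod_closed S /\
  forall u v, v \in S -> mul u v \in S /\ mul v u \in S.

End Span.

(* The quotient V / lspan A: the library's quotient of additive groups, with
   scalar multiplication added. *)
Section QuotientModule.
Variables (F : fieldType) (V : lmodType F) (A : set V).

Definition lquot : Type := Quotient.quot (lspan A).

HB.instance Definition _ := GRing.Zmodule.on lquot.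
HB.instance Definition _ := EqQuotient.on lquot.

Definition lproj (v : V) : lquot := \pi_lquot v.

Definition lquot_scale (a : F) (x : lquot) : lquot := lproj (a *: repr x).

Lemma lproj_surj x : exists v, x = lproj v.
Proof. by exists (repr x); rewrite /lproj reprK. Qed.

Lemma lproj_eq u v : (lproj u == lproj v) = (u - v \in lspan A).
Proof. by rewrite [RHS](@Quotient.idealrBE V (lspan A)). Qed.

Lemma lprojD u v : lproj (u + v) = lproj u + lproj v.
Proof. exact: (@pi_addr _ _ _ _ _ (Quotient.quot (lspan A))). Qed.

Lemma lprojZ a u : lproj (a *: u) = lquot_scale a (lproj u).
Proof.
apply/eqP; rewrite lproj_eq -scalerBr rpredZ //.
by rewrite -lproj_eq /lproj reprK.
Qed.

Lemma lquot_scaleA a b x :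
  lquot_scale a (lquot_scale b x) = lquot_scale (a * b) x.
Proof. by have [v ->] := lproj_surj x; rewrite -!lprojZ scalerA. Qed.

Lemma lquot_scale1 : left_id 1 lquot_scale.
Proof. by move=> x; have [v ->] := lproj_surj x; rewrite -lprojZ scale1r. Qed.

Lemma lquot_scaleDr : right_distributive lquot_scale +%R.
Proof.
move=> a x y; have [u ->] := lproj_surj x; have [v ->] := lproj_surj y.
by rewrite -lprojD -!lprojZ scalerDr lprojD.
Qed.

Lemma lquot_scaleDl x : {morph lquot_scale^~ x : a b / a + b}.
Proof.
by move=> a b; have [v ->] := lproj_surj x; rewrite -!lprojZ -lprojD scalerDl.
Qed.

HB.instance Definition _ := GRing.Zmodule_isLmodule.Build F lquot
  lquot_scaleA lquot_scale1 lquot_scaleDr lquot_scaleDl.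

Lemma lproj_linear : linear lproj.
Proof. by move=> a u v; rewrite lprojD lprojZ. Qed.

HB.instance Definition _ :=
  GRing.isLinear.Build F V lquot _ lproj lproj_linear.

End QuotientModule.

Section ZhuAlgebra.
Variables (F : fieldType) (V : lmodType F) (X : weakQVA V) (n : nat).

Definition Ogen : set V :=
  range (Dop X) `|` [set w | exists u v, w = circ X n u v].

Definition Otilde : {pred V} := lspan Ogen.

(* V / Otilde *)
Definition Atilde : lmodType F := lquot Ogen.

Definition Aproj (v : V) : Atilde := lproj Ogen v.

End ZhuAlgebra.

(* Main.v *)
From HB Require Import structures.
Require Import Defs.
From mathcomp Require Import all_boot all_order all_algebra sesquilinear.
From mathcomp Require Import boolp classical_sets functions fsbigop reals.
From mathcomp Require Import ring zify.

Set Implicit Arguments.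
Unset Strict Implicit.
Unset Printing Implicit Defensive.

Import Order.TTheory GRing.Theory Num.Theory.
Local Open Scope classical_set_scope.
Local Open Scope ring_scope.

(** For a Laurent series f let K_f(u, v) be the residue of f(x) Y(u, x) v
    ([resY]); both products are of this form.  Put w = 1 / (e^x - 1).  The
    kernels that occur are polynomials in w, a ring stable under d/dx, because
    w' = - w (1 + w), and under x |-> - x, which sends w to - 1 - w.  The kernel
    of the product circ is (w (1 + w))^(n+1); let I be the ideal it generates in
    F[w].  The kernel of the product star is s = S(w), where S is (1 + w)^(n+1)
    times the truncation at degree n of the binomial series of (1 + w)^(-n-1).
    So S is congruent to 1 modulo w^(n+1) and to 0 modulo (1 + w)^(n+1): modulo
    I it is an idempotent.  Hence ds/dx lies in I ([lder_star_poly]), and so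
    does s(x) s(- x), the reflection exchanging w and 1 + w up to sign
    ([star_poly_orthogonal]).

    The Jacobi identity at a fixed exponent of x0, or of x1, yields two rules for
    powers of x, which extend to Laurent series by linearity and continuity.
    [commutator] exchanges K_f(u, -) and K_g(v, -) up to terms with kernels
    g h, where h = f^(k) / k!.  [iterate] expands K_g(K_f(u, v), w) into terms
    K_h(u, -), with h as before, and terms with outer kernel g times a divided
    derivative of f(- x).  Write df for the derivative of f.  Then moreover
    D K_f(u, v) = K_f(u, D v) - K_df(u, v) and K_f(D u, v) = - K_df(u, v).

    Let O be the span of D V and of the circ products.  By the formula for
    D K_f(u, v), the set of kernels f with all K_f(u, v) in O is stable under
    d/dx.  Differentiating (w (1 + w))^(n+1) w^m produces the next power of w
    with a nonzero coefficient, so that set contains all of I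
    ([circ_ideal_null]).  The rest is reading off kernels: a product with one
    factor in O expands, up to D V, into terms with a kernel in I, and
    (a * b) * c expands into a * (b * c) plus terms whose kernel is a derivative
    of s, or s times a divided derivative of s(- x), possibly of order 0; all of
    these are in I. *)

(** * Formal products as finite sums *)

Lemma fsbig_range (V : zmodType) (I : choiceType) (phi : nat -> I) (M : nat)
    (G : I -> V) :
  injective phi -> (forall i, (forall k, (k < M)%N -> i <> phi k) -> G i = 0) ->
  \sum_(i \in [set: I]) G i = \sum_(k < M) G (phi k).
Proof.
move=> phi_inj G0.
rewrite (fsbigE [seq phi k | k <- iota 0 M]) //.
- rewrite big_map (eq_bigl predT) => [|k]; last by rewrite in_setT.
  by rewrite -{1}[M]subn0 big_mkord.
- by rewrite map_inj_uniq ?iota_uniq.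
- move=> i _ iN; apply: G0 => k kM ik; move/negP: iN; apply.
  by rewrite ik map_f // mem_iota.
Qed.

Definition order_ge (V : zmodType) (a : int) (g : int -> V) :=
  forall k, k < a -> g k = 0.

Section Product.
Variables (F : fieldType) (V : lmodType F).

Lemma fmulE (f : int -> F) (g : int -> V) (a b n : int) (M : nat) :
  order_ge a f -> order_ge b g -> n - a - b < M%:Z ->
  fmul f g n = \sum_(k < M) f (n - b - k%:Z) *: g (b + k%:Z).
Proof.
move=> fa gb nM; rewrite /fmul (@fsbig_range _ _ (fun k => b + k%:Z) M).
- by apply: eq_bigr => k _; rewrite opprD addrA.
- by move=> i j /addrI [].
- move=> i iN; have [ib|bi] := ltP i b; first by rewrite gb ?scaler0.
  have [iM|Mi] := ltP (i - b) M%:Z; last by rewrite fa ?scale0r //; lia.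
  by case: (iN `|i - b|%N); lia.
Qed.

Lemma fmul_order_ge (f : int -> F) (g : int -> V) a b :
  order_ge a f -> order_ge b g -> order_ge (a + b) (fmul f g).
Proof.
by move=> fa gb n nab; rewrite (@fmulE _ _ a b n 0) ?big_ord0//; lia.
Qed.

End Product.

(** * The ring of Laurent series *)

Section LaurentRing.
Variable F : fieldType.
Implicit Types (f g h : int -> F) (a b n : int).

Definition lser : {pred int -> F} := fun f => `[< is_laurent f >].

Lemma lserP f : reflect (exists a, order_ge a f) (f \in lser).
Proof. exact: asboolP. Qed.

Lemma order_ge_le a b (V : zmodType) (g : int -> V) : b <= a -> order_ge a g ->
  order_ge b g.
Proof. by move=> ba ga k kb; apply: ga; lia. Qed.

Lemma lser_zmod_closed : zmod_closed lser.
Proof.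
split=> [|f g /lserP[a fa] /lserP[b gb]]; apply/lserP; first by exists 0.
by exists (Num.min a b) => k; rewrite lt_min => /andP[/fa ka /gb kb];
  rewrite !fctE ka kb subrr.
Qed.

HB.instance Definition _ :=
  GRing.isZmodClosed.Build (int -> F) lser lser_zmod_closed.

Record laurent := Laurent { lcoef :> int -> F ; lcoefP : lcoef \in lser }.

HB.instance Definition _ := [isSub for lcoef].
HB.instance Definition _ := [Choice of laurent by <:].
HB.instance Definition _ := [SubChoice_isSubZmodule of laurent by <:].

Lemma laurentP (f g : laurent) : lcoef f =1 lcoef g -> f = g.
Proof. by move=> fg; apply/val_inj/funext. Qed.

Lemma laurent_order_ge (f : laurent) : exists a, order_ge a f.
Proof. exact/lserP/lcoefP. Qed.

Lemma lcoefD (f g : laurent) k : (f + g) k = f k + g k. Proof. by []. Qed.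
Lemma lcoefN (f : laurent) k : (- f) k = - f k. Proof. by []. Qed.
Lemma lcoefB (f g : laurent) k : (f - g) k = f k - g k. Proof. by []. Qed.

Lemma lscale_subproof (c : F) (f : laurent) : (fun k => c * f k) \in lser.
Proof.
have [a fa] := laurent_order_ge f.
by apply/lserP; exists a => k /fa->; rewrite mulr0.
Qed.
Definition lscale c (f : laurent) := Laurent (lscale_subproof c f).

Lemma lscaleA c d (f : laurent) : lscale c (lscale d f) = lscale (c * d) f.
Proof. by apply: laurentP => k /=; rewrite mulrA. Qed.
Lemma lscale1 : left_id 1 lscale.
Proof. by move=> f; apply: laurentP => k /=; rewrite mul1r. Qed.
Lemma lscaleDr : right_distributive lscale +%R.
Proof. by move=> c f g; apply: laurentP => k; rewrite /= mulrDr. Qed.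
Lemma lscaleDl (f : laurent) : {morph lscale^~ f : c d / c + d}.
Proof. by move=> c d; apply: laurentP => k; rewrite /= mulrDl. Qed.
HB.instance Definition _ :=
  GRing.Zmodule_isLmodule.Build F laurent lscaleA lscale1 lscaleDr lscaleDl.

Lemma lcoefZ c (f : laurent) k : (c *: f) k = c * f k. Proof. by []. Qed.

(** x^(-a) f(x) modulo x^N.  Coefficients of products of Laurent series are
    read off from products of such polynomials, so that associativity and
    commutativity come from those of [{poly F}]. *)
Definition ltrunc (N : nat) (a : int) f : {poly F} := \poly_(i < N) f (a + i%:Z).

Lemma lmulE f g a b n (M : nat) : order_ge a f -> order_ge b g ->
  n - a - b < M%:Z ->
  lmul f g n = \sum_(k < M) f (n - b - k%:Z) * g (b + k%:Z).
Proof. exact: (@fmulE F F^o). Qed.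

Lemma lmul_trunc f g a b (N m : nat) : order_ge a f -> order_ge b g -> (m < N)%N ->
  lmul f g (a + b + m%:Z) = (ltrunc N a f * ltrunc N b g)`_m.
Proof.
move=> fa gb mN; rewrite (@lmulE f g a b _ m.+1) //; last by lia.
rewrite coefMr; apply: eq_bigr => k _.
have km := ltn_ord k.
rewrite !coef_poly (leq_ltn_trans (leq_subr _ _) mN) (leq_trans km mN).
by congr (f _ * g _); lia.
Qed.

Lemma lmul_order_ge f g a b : order_ge a f -> order_ge b g ->
  order_ge (a + b) (lmul f g).
Proof. exact: (@fmul_order_ge F F^o). Qed.

Lemma lmul_subproof (f g : laurent) : lmul f g \in lser.
Proof.
have [[a fa] [b gb]] := (laurent_order_ge f, laurent_order_ge g).
by apply/lserP; exists (a + b); exact: lmul_order_ge.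
Qed.
Definition lmulL (f g : laurent) := Laurent (lmul_subproof f g).

Lemma lmulC f g a b : order_ge a f -> order_ge b g -> lmul f g = lmul g f.
Proof.
move=> fa gb; apply/funext => n.
have [nab|abn] := ltP n (a + b).
  by rewrite (lmul_order_ge fa gb) // (lmul_order_ge gb fa) // addrC.
have -> : n = a + b + (absz (n - (a + b))%R)%:Z by lia.
rewrite (lmul_trunc fa gb (ltnSn _)) mulrC -lmul_trunc //.
by congr lmul; lia.
Qed.

Lemma lmulA f g h a b c : order_ge a f -> order_ge b g -> order_ge c h ->
  lmul f (lmul g h) = lmul (lmul f g) h.
Proof.
move=> fa gb hc; apply/funext => n.
have [gh fg] := (lmul_order_ge gb hc, lmul_order_ge fa gb).
have [nab|abn] := ltP n (a + b + c).
  by rewrite (lmul_order_ge fg hc) // (lmul_order_ge fa gh) // addrA.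
set m := absz (n - (a + b + c))%R.
have trM u v i j : order_ge i u -> order_ge j v ->
    forall k, (k <= m)%N -> (ltrunc m.+1 (i + j) (lmul u v))`_k =
      (ltrunc m.+1 i u * ltrunc m.+1 j v)`_k.
  by move=> ui vj k km; rewrite coef_poly ltnS km (@lmul_trunc _ _ _ _ m.+1).
have -> : n = a + (b + c) + m%:Z by rewrite /m; lia.
rewrite (lmul_trunc fa gh (ltnSn m)) addrA (lmul_trunc fg hc (ltnSn m)).
transitivity ((ltrunc m.+1 a f * ltrunc m.+1 b g * ltrunc m.+1 c h)`_m).
  rewrite -mulrA !coefM; apply: eq_bigr => i _.
  by rewrite trM // leq_subr.
by rewrite !coefM; apply: eq_bigr => i _; rewrite trM // -ltnS ltn_ord.
Qed.

Lemma lmulDl f g h a b c : order_ge a f -> order_ge b g -> order_ge c h ->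
  lmul (f + g) h = lmul f h + lmul g h.
Proof.
move=> fa gb hc; apply/funext => n; rewrite -[RHS]/(lmul f h n + lmul g h n).
pose e := Num.min a b; pose M := (absz (n - e - c)%R).+1.
have fe : order_ge e f by apply: order_ge_le fa; rewrite ge_min lexx.
have ge : order_ge e g by apply: order_ge_le gb; rewrite ge_min lexx orbT.
have fge : order_ge e (f + g) by move=> k ke; rewrite fctE fe // ge // addr0.
have Mn : n - e - c < M%:Z by rewrite /M; lia.
rewrite (lmulE fge hc Mn) (lmulE fe hc Mn) (lmulE ge hc Mn).
rewrite -big_split; apply: eq_bigr => k _ /=.
exact: mulrDl.
Qed.

Lemma order_ge_lone : order_ge 0 (lone F).
Proof. by move=> k k0; rewrite /lone lt_eqF. Qed.

Lemma lmul_monomial m f a n : order_ge a f ->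
  lmul (fun k => (k == m)%:R) f n = f (n - m).
Proof.
move=> fa.
have Xm : order_ge m (fun k => (k == m)%:R : F) by move=> k km; rewrite lt_eqF.
have [na|an] := ltP (n - m) a; first by rewrite (lmul_order_ge Xm fa) ?fa //; lia.
rewrite (@lmulE _ _ m a n (absz (n - m - a)%R).+1 Xm fa); last by lia.
rewrite big_ord_recr big1 /= => [|k _]; last first.
  by rewrite (_ : _ == m = false) ?mul0r //; have := ltn_ord k; lia.
rewrite add0r (_ : _ == m = true) ?mul1r; last by lia.
by congr f; lia.
Qed.

Lemma lmul1 f a : order_ge a f -> lmul (lone F) f = f.
Proof. by move=> fa; apply/funext => n; rewrite (lmul_monomial _ _ fa) subr0. Qed.

Lemma lone_subproof : lone F \in lser.
Proof. by apply/lserP; exists 0; exact: order_ge_lone. Qed.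
Definition loneL := Laurent lone_subproof.

Lemma lmulLA : associative lmulL.
Proof.
move=> f g h; apply/val_inj => /=.
have [[a fa] [b gb]] := (laurent_order_ge f, laurent_order_ge g).
have [c hc] := laurent_order_ge h.
exact: lmulA fa gb hc.
Qed.
Lemma lmulLC : commutative lmulL.
Proof.
move=> f g; apply/val_inj => /=.
have [[a fa] [b gb]] := (laurent_order_ge f, laurent_order_ge g).
exact: lmulC fa gb.
Qed.
Lemma lmul1L : left_id loneL lmulL.
Proof.
by move=> f; apply/val_inj; have [a fa] := laurent_order_ge f; exact: lmul1 fa.
Qed.
Lemma lmulLDl : left_distributive lmulL +%R.
Proof.
move=> f g h; apply/val_inj => /=.
have [[a fa] [b gb]] := (laurent_order_ge f, laurent_order_ge g).
have [c hc] := laurent_order_ge h.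
exact: lmulDl fa gb hc.
Qed.
Lemma loneL_neq0 : loneL != 0.
Proof.
apply/eqP => /(congr1 (fun f : laurent => f 0)) /eqP.
by rewrite /= /lone eqxx oner_eq0.
Qed.

HB.instance Definition _ := GRing.Zmodule_isComNzRing.Build laurent
  lmulLA lmulLC lmul1L lmulLDl loneL_neq0.

Lemma lscaleAl c (f g : laurent) : c *: (f * g) = (c *: f) * g.
Proof.
have [[a fa] [b gb]] := (laurent_order_ge f, laurent_order_ge g).
apply: laurentP => n; have nM : n - a - b < (absz (n - a - b)%R).+1%:Z by lia.
have cfa : order_ge a (c *: f) by move=> k /fa; rewrite lcoefZ => ->; rewrite mulr0.
rewrite lcoefZ [X in _ * X](lmulE fa gb nM) [RHS](lmulE cfa gb nM) mulr_sumr.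
by apply: eq_bigr => k _; rewrite mulrA.
Qed.

HB.instance Definition _ := GRing.Lmodule_isLalgebra.Build F laurent lscaleAl.
HB.instance Definition _ := GRing.Lalgebra_isComAlgebra.Build F laurent.

Lemma lcoefM (f g : laurent) : (f * g : laurent) = lmul f g :> (int -> F).
Proof. by []. Qed.

End LaurentRing.

(** * Derivation and reflection of Laurent series *)

Section LaurentCalculus.
Variable F : fieldType.
Implicit Types (f g h : laurent F) (a b n m : int).
Local Notation L := (laurent F).

Lemma order_ge_lin (V : lmodType F) a (c : F) (f g : int -> V) :
  order_ge a f -> order_ge a g -> order_ge a (c *: f + g).
Proof. by move=> fa ga k ka; rewrite !fctE fa // ga // scaler0 addr0. Qed.

Lemma lX_subproof m : (fun k => (k == m)%:R) \in @lser F.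
Proof. by apply/lserP; exists m => k km; rewrite lt_eqF. Qed.
(** x^m *)
Definition lX m : L := Laurent (lX_subproof m).

Lemma order_ge_lX m : order_ge m (lX m).
Proof. by move=> k km; rewrite /= lt_eqF. Qed.

Lemma lcoefXM m f k : (lX m * f) k = f (k - m).
Proof. by have [a fa] := laurent_order_ge f; exact: lmul_monomial fa. Qed.

Lemma lXD m n : lX m * lX n = lX (m + n).
Proof. by apply: laurentP => k; rewrite lcoefXM /= subr_eq addrC. Qed.

Lemma lX0 : lX 0 = 1. Proof. exact: laurentP. Qed.

Lemma lmul_order_geL a b f g : order_ge a f -> order_ge b g ->
  order_ge (a + b) (f * g).
Proof. exact: lmul_order_ge. Qed.

(** A linear map that vanishes on series of large order only sees finitely many
    coefficients; peel them off one at a time, starting from the lowest. *)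
Lemma laurent_ext (W : lmodType F) (phi : L -> W) a :
  linear phi -> (exists N, forall f, order_ge N f -> phi f = 0) ->
  (forall m, a <= m -> phi (lX m) = 0) -> forall f, order_ge a f -> phi f = 0.
Proof.
move=> phi_lin [N phiN].
have: N <= a + (absz (N - a)%R)%:Z by lia.
move: (absz (N - a)%R) => M; elim: M a => [|M IH] a NaM phiX f fa.
  by apply/phiN/order_ge_le/fa; lia.
pose f' := - f a *: lX a + f.
have -> : f = f a *: lX a + f' by rewrite addrA scaleNr subrr add0r.
rewrite phi_lin phiX // scaler0 add0r (IH (a + 1)) //; try lia.
  by move=> m am; apply: phiX; lia.
move=> k ka; rewrite lcoefD lcoefZ /=; have [->|kNa] := eqVneq k a.
  by rewrite mulr1 addNr.
by rewrite mulr0 add0r fa //; lia.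
Qed.

Lemma lder_subproof f : (fun k : int => (k + 1)%:~R * f (k + 1)) \in @lser F.
Proof.
have [a fa] := laurent_order_ge f; apply/lserP; exists (a - 1) => k ka.
by rewrite fa ?mulr0 //; lia.
Qed.
Definition lder f : L := Laurent (lder_subproof f).

Lemma lderE f k : lder f k = (k + 1)%:~R * f (k + 1). Proof. by []. Qed.

Lemma lder_linear : linear lder.
Proof.
move=> c f g; apply: laurentP => k.
by rewrite !(lcoefD, lcoefZ, lderE); ring.
Qed.
HB.instance Definition _ := GRing.isLinear.Build F L L _ lder lder_linear.

Lemma lder_order_ge a f : order_ge a f -> order_ge (a - 1) (lder f).
Proof. by move=> fa k ka /=; rewrite fa ?mulr0 //; lia. Qed.

Lemma lder_lX m : lder (lX m) = m%:~R *: lX (m - 1).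
Proof.
apply: laurentP => k; rewrite lcoefZ /= [k == m - 1]eq_sym subr_eq eq_sym.
by have [->|] := eqVneq (k + 1) m; rewrite ?mulr0.
Qed.

Lemma lderM f g : lder (f * g) = lder f * g + f * lder g.
Proof.
have [[a fa] [b gb]] := (laurent_order_ge f, laurent_order_ge g).
apply: laurentP => n; pose M := (absz (n + 1 - a - b)%R).+1.
have [dfa dgb] := (lder_order_ge fa, lder_order_ge gb).
rewrite lcoefD /= (@lmulE _ f g a b (n + 1) M) //; last by rewrite /M; lia.
rewrite (lmulE (M := M) dfa gb); last by rewrite /M; lia.
rewrite (lmulE (M := M) fa dgb); last by rewrite /M; lia.
rewrite -big_split mulr_sumr; apply: eq_bigr => k _ /=.
have -> : n - b - k%:Z + 1 = n + 1 - b - k%:Z by lia.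
have -> : b - 1 + k%:Z + 1 = b + k%:Z by lia.
have -> : n - (b - 1) - k%:Z = n + 1 - b - k%:Z by lia.
rewrite -[X in X%:~R * (_ * _)](subrK (b + k%:Z)) [in LHS]rmorphD.
have -> : n + 1 - (b + k%:Z) = n + 1 - b - k%:Z by lia.
by rewrite /=; ring.
Qed.

Lemma lrefl_subproof f : (fun k : int => (-1) ^ k * f k) \in @lser F.
Proof.
have [a fa] := laurent_order_ge f; apply/lserP; exists a => k ka.
by rewrite fa ?mulr0.
Qed.
(** f(- x) *)
Definition lrefl f : L := Laurent (lrefl_subproof f).

Lemma lreflE f k : lrefl f k = (-1) ^ k * f k. Proof. by []. Qed.

Lemma lrefl_linear : linear lrefl.
Proof.
by move=> c f g; apply: laurentP => k; rewrite !(lcoefD, lcoefZ, lreflE); ring.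
Qed.
HB.instance Definition _ := GRing.isLinear.Build F L L _ lrefl lrefl_linear.

Lemma lrefl_order_ge a f : order_ge a f -> order_ge a (lrefl f).
Proof. by move=> fa k ka /=; rewrite fa ?mulr0. Qed.

Lemma lrefl_lX m : lrefl (lX m) = (-1) ^ m *: lX m.
Proof.
apply: laurentP => k; rewrite lcoefZ /=.
by have [->|] := eqVneq k m; rewrite ?mulr0.
Qed.

Lemma lreflM f g : lrefl (f * g) = lrefl f * lrefl g.
Proof.
have [[a fa] [b gb]] := (laurent_order_ge f, laurent_order_ge g).
apply: laurentP => n; pose M := (absz (n - a - b)%R).+1.
have nM : n - a - b < M%:Z by rewrite /M; lia.
rewrite /= (lmulE fa gb nM) (lmulE (lrefl_order_ge fa) (lrefl_order_ge gb) nM)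
  mulr_sumr.
apply: eq_bigr => k _ /=; rewrite mulrACA; congr (_ * _).
by rewrite -expfzDr ?oppr_eq0 ?oner_eq0 //; congr (_ ^ _); lia.
Qed.

Lemma lrefl1 : lrefl 1 = 1.
Proof. by rewrite -lX0 lrefl_lX expr0z scale1r. Qed.

Lemma lder_lrefl f : lder (lrefl f) = - lrefl (lder f).
Proof.
apply: laurentP => k; rewrite lcoefN /= expfzDr ?oppr_eq0 ?oner_eq0 // expr1z.
by ring.
Qed.

(** The divided derivative f^(k) / k!, the coefficient of y^k in f(x + y). *)
Definition hasse (k : nat) f : L := k`!%:R^-1 *: iter k lder f.

Lemma hasse_linear k : linear (hasse k).
Proof.
move=> c f g; rewrite /hasse; have -> : iter k lder (c *: f + g) =
    c *: iter k lder f + iter k lder g.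
  by elim: k => //= k ->; rewrite linearP.
by rewrite scalerDr !scalerA mulrC.
Qed.
HB.instance Definition _ k := GRing.isLinear.Build F L L _ (hasse k)
  (hasse_linear k).

Lemma hasse_order_ge k a f : order_ge a f -> order_ge (a - k%:Z) (hasse k f).
Proof.
move=> fa n nak; rewrite /hasse lcoefZ.
suff -> : iter k lder f n = 0 by rewrite mulr0.
elim: k a f fa n nak => [|k IH] a f fa n nak; first by rewrite /= fa //; lia.
by rewrite iterSr (IH (a - 1)) //; [exact: lder_order_ge | lia].
Qed.

Lemma hasse0 f : hasse 0 f = f.
Proof. by rewrite /hasse fact0 invr1 scale1r. Qed.

Lemma hasse1 f : hasse 1 f = lder f.
Proof. by rewrite /hasse factS fact0 invr1 scale1r. Qed.

Lemma hasse_lX k m : hasse k (lX m) = gbinom m%:~R k *: lX (m - k%:Z).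
Proof.
rewrite /hasse /gbinom; have -> : iter k lder (lX m) =
    (\prod_(j < k) (m%:~R - j%:R)) *: lX (m - k%:Z).
  elim: k => [|k IH]; first by rewrite big_ord0 scale1r subr0.
  rewrite iterS IH linearZ /= lder_lX scalerA big_ord_recr /=.
  by congr (_ * _ *: lX _); [rewrite rmorphB | lia].
by rewrite scalerA mulrC.
Qed.

End LaurentCalculus.

(** * Inverses of Laurent series *)

Section LaurentInverse.
Variable F : fieldType.
Local Notation L := (laurent F).

(** The first m coefficients of the inverse of the power series p, computed one
    after the other from the convolution equations. *)
Fixpoint inv_coefs (p : nat -> F) (m : nat) : seq F :=
  if m is k.+1 then let s := inv_coefs p k in
    rcons s (((k == 0)%:R - \sum_(j < k) p (k - j)%N * s`_j) / p 0%N)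
  else [::].

Lemma size_inv_coefs p m : size (inv_coefs p m) = m.
Proof. by elim: m => //= m IH; rewrite size_rcons IH. Qed.

Lemma nth_inv_coefs p m k : (k < m)%N -> (inv_coefs p m)`_k = (inv_coefs p k.+1)`_k.
Proof.
elim: m => // m IH; rewrite ltnS leq_eqVlt => /predU1P[->//|km].
by rewrite /= nth_rcons size_inv_coefs km IH.
Qed.

Lemma conv_inv_coefs p m : p 0%N != 0 ->
  \sum_(k < m.+1) p (m - k)%N * (inv_coefs p k.+1)`_k = (m == 0)%:R.
Proof.
move=> p0; rewrite big_ord_recr.
under eq_bigr => k _ do rewrite -(nth_inv_coefs p (ltn_ord k)).
rewrite /= subnn nth_rcons size_inv_coefs ltnn eqxx mulrC divfK //.
by rewrite addrC subrK.
Qed.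

Lemma laurent_inv (f : L) a : order_ge a f -> f a != 0 -> exists g : L, f * g = 1.
Proof.
move=> fa fa0; pose p k := f (a + k%:Z).
pose q (k : int) :=
  if 0 <= k + a then (inv_coefs p (absz (k + a)).+1)`_(absz (k + a)) else 0.
have qa : order_ge (- a) q by move=> k ka; rewrite /q ifF //; lia.
have qL : q \in @lser F by apply/lserP; exists (- a).
exists (Laurent qL); apply: laurentP => n.
have [n0|n0] := ltP n 0.
  have fq : order_ge 0 (f * Laurent qL) by rewrite -(subrr a);
    exact: lmul_order_geL.
  by rewrite fq // [RHS](@order_ge_lone F).
pose m := absz n; have -> : n = m by rewrite /m; lia.
rewrite lcoefM (@lmulE _ f q a (- a) m m.+1) //; last by lia.
rewrite [RHS](_ : _ = (m == 0%N)%:R) // -(@conv_inv_coefs p) ?/p ?addr0 //.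
apply: eq_bigr => k _; have := ltn_ord k => km; congr (f _ * _); first by lia.
by rewrite /q ifT; [congr (_ `_ _); [congr inv_coefs|]; lia | lia].
Qed.

End LaurentInverse.

(** * Polynomials in 1 / (e^x - 1) *)

Section Exponential.
Variable F : numFieldType.
Implicit Types (a b : F) (P Q : {poly F}).
Local Notation L := (laurent F).

Lemma order_ge_lexp a : order_ge 0 (lexp a).
Proof. by case. Qed.
Lemma lexp_subproof a : lexp a \in @lser F.
Proof. by apply/lserP; exists 0; exact: order_ge_lexp. Qed.
Definition lexpL a : L := Laurent (lexp_subproof a).

Lemma lexpD a b : lexpL (a + b) = lexpL a * lexpL b.
Proof.
apply: laurentP => -[m|m]; last first.
  by rewrite [RHS](lmul_order_ge (@order_ge_lexp a) (@order_ge_lexp b)).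
rewrite lcoefM (@lmulE _ _ _ 0 0 m m.+1 (@order_ge_lexp a) (@order_ge_lexp b));
  last by lia.
rewrite [LHS]/= exprDn mulr_suml; apply: eq_bigr => k _.
have km : (k <= m)%N by rewrite -ltnS ltn_ord.
rewrite subr0 add0r subzn //= -(bin_fact km) !natrM.
have f0 j : j`!%:R != 0 :> F by rewrite pnatr_eq0 -lt0n fact_gt0.
have b0 : 'C(m, k)%:R != 0 :> F by rewrite pnatr_eq0 -lt0n bin_gt0.
by rewrite -mulr_natr; field; rewrite !f0 b0.
Qed.

Lemma lexp0 : lexpL 0 = 1.
Proof.
apply: laurentP => -[[|m]|m] //=; first by rewrite expr0 fact0 divr1.
by rewrite expr0n mul0r.
Qed.

Lemma lexp_nat n : lexpL n%:R = lexpL 1 ^+ n.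
Proof. by elim: n => [|n IH]; rewrite ?lexp0 // -natr1 lexpD IH exprSr. Qed.

Lemma lder_lexp a : lder (lexpL a) = a *: lexpL a.
Proof.
apply: laurentP => -[m|m]; rewrite lderE lcoefZ /=; last first.
  case: m => [|m]; first by rewrite mul0r mulr0.
  by rewrite !mulr0.
rewrite -PoszD addn1 factS natrM exprS /=.
have f0 j : j`!%:R != 0 :> F by rewrite pnatr_eq0 -lt0n fact_gt0.
have s0 : m.+1%:R != 0 :> F by rewrite pnatr_eq0.
rewrite -[m.+1%:~R]/(m.+1%:R); move: (m.+1%:R) s0 => s s0.
by field; rewrite s0 f0.
Qed.

Lemma lrefl_lexp a : lrefl (lexpL a) = lexpL (- a).
Proof.
apply: laurentP => -[m|m]; rewrite lreflE /=; last by rewrite mulr0.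
by rewrite exprNn mulrA.
Qed.

Lemma bern_subproof : exists w : L, (lexpL 1 - 1) * w = 1.
Proof.
apply: (@laurent_inv _ _ 1) => [k k1|]; rewrite lcoefB /=.
  have [->|k0] := eqVneq k 0; first by rewrite /= expr0 divr1 /lone eqxx subrr.
  by rewrite order_ge_lexp /lone ?(negPf k0) ?subrr //; lia.
by rewrite /lone subr0 divr1 oner_eq0.
Qed.
(** 1 / (e^x - 1): up to a factor x, the generating series of the Bernoulli
    numbers. *)
Definition bern : L := projT1 (cid bern_subproof).
Lemma bernP : (lexpL 1 - 1) * bern = 1.
Proof. exact: projT2 (cid bern_subproof). Qed.

Lemma lexp_bern : lexpL 1 * bern = 1 + bern.
Proof. by rewrite -bernP; ring. Qed.

(** Differentiate (e^x - 1) w = 1, multiply by w and use e^x w = 1 + w. *)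
Lemma lder_bern : lder bern = - bern * (1 + bern).
Proof.
have der1 : lder (1 : L) = 0 by rewrite -(lX0 F) lder_lX scale0r.
have /(congr1 (@lder F)) := bernP; rewrite lderM linearB /= der1 lder_lexp subr0
  scale1r.
move=> /(congr1 (fun f => f * bern)); rewrite mul0r lexp_bern mulrDl.
rewrite -mulrA [lder bern * bern]mulrC mulrA bernP mul1r => /eqP.
by rewrite addrC addr_eq0 mulNr mulrC => /eqP.
Qed.

(** Inverses are unique, and e^(-x) (1 + w) = w makes - 1 - w inverse to
    e^(-x) - 1. *)
Lemma lrefl_bern : lrefl bern = - 1 - bern.
Proof.
have /(congr1 (@lrefl F)) := bernP; rewrite lreflM linearB /= lrefl1 lrefl_lexp
  => reflP.
have e1 : lexpL (- 1) * lexpL 1 = 1 by rewrite -lexpD addNr lexp0.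
have key : (lexpL (- 1) - 1) * (- 1 - bern) = 1.
  have eb : lexpL (-1) * (1 + bern) = bern by rewrite -lexp_bern mulrA e1 mul1r.
  by rewrite mulrBl mul1r -opprD mulrN eb; ring.
by rewrite -[RHS]mul1r -{1}reflP -mulrA [lrefl _ * _]mulrC mulrA key mul1r.
Qed.

(** P(w) for w = 1 / (e^x - 1). *)
Definition bpoly P : L := horner_alg bern P.

Lemma lder_bpoly P : lder (bpoly P) = bpoly (- 'X * (1 + 'X) * P^`()).
Proof.
rewrite /bpoly; elim/poly_ind: P => [|P c IH];
  first by rewrite deriv0 mulr0 !rmorph0 linear0.
rewrite derivD derivM derivX derivC mulr1 addr0.
rewrite !(rmorphD, rmorphM, rmorphN, rmorph1) /=.
rewrite horner_algX horner_algC linearD linearZ /= lderM IH lder_bern.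
have -> : lder (1 : L) = 0 by rewrite -(lX0 F) lder_lX scale0r.
by rewrite !(rmorphD, rmorphM, rmorphN, rmorph1) /= horner_algX scaler0; ring.
Qed.

Lemma lrefl_bpoly P : lrefl (bpoly P) = bpoly (P \Po (- 1 - 'X)).
Proof.
rewrite /bpoly; elim/poly_ind: P => [|P c IH];
  first by rewrite comp_poly0 rmorph0 linear0.
rewrite comp_polyD comp_polyM comp_polyX comp_polyC !(rmorphD, rmorphM) /=.
rewrite !horner_algX !horner_algC linearD linearZ /= lreflM IH lrefl_bern lrefl1.
by rewrite !rmorphN rmorph1 /= horner_algX.
Qed.

Lemma bpolyM P Q : bpoly (P * Q) = bpoly P * bpoly Q.
Proof. exact: rmorphM. Qed.

Lemma bpolyZ (c : F) P : bpoly (c *: P) = c *: bpoly P.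
Proof. by rewrite -mul_polyC bpolyM {1}/bpoly horner_algC mulr_algl. Qed.

Lemma bpoly_sum m (c : 'I_m -> F) (P : 'I_m -> {poly F}) :
  bpoly (\sum_(i < m) c i *: P i) = \sum_(i < m) c i *: bpoly (P i).
Proof. by rewrite /bpoly rmorph_sum; apply: eq_bigr => i _; exact: bpolyZ. Qed.

End Exponential.

(** * Residues of vertex operators *)

Section Residues.
Variables (F : numFieldType) (V : lmodType F) (X : weakQVA V).
Implicit Types (f g h : laurent F) (u v w : V).
Local Notation L := (laurent F).
Local Notation Y := (vop X).

(** Res_x f(x) Y(u, x) v *)
Definition resY f u v : V := Res (fmul f (Y u v)).

Lemma resYE f u v a b (M : nat) : order_ge a f -> order_ge b (Y u v) ->
  - 1 - a - b < M%:Z ->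
  resY f u v = \sum_(k < M) f (- 1 - b - k%:Z) *: Y u v (b + k%:Z).
Proof. exact: fmulE. Qed.

Lemma resY_linear_series u v : linear (fun f => resY f u v).
Proof.
move=> c f g; have [b Yb] := vop_laurent X u v.
have [[af faf] [ag gag]] := (laurent_order_ge f, laurent_order_ge g).
have fa : order_ge (Num.min af ag) f by apply: order_ge_le faf; rewrite ge_min lexx.
have ga : order_ge (Num.min af ag) g.
  by apply: order_ge_le gag; rewrite ge_min lexx orbT.
move: (Num.min af ag) fa ga => a fa ga.
have ha : order_ge a (c *: f + g).
  by move=> k ka; rewrite lcoefD lcoefZ fa // ga // mulr0 addr0.
pose M := (absz (- 1 - a - b)%R).+1.
have aM : - 1 - a - b < M%:Z by rewrite /M; lia.
rewrite (resYE fa Yb aM) (resYE ga Yb aM) (resYE ha Yb aM) scaler_sumr -big_split.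
by apply: eq_bigr => k _ /=; rewrite scalerDl scalerA.
Qed.

Lemma resY_linear_right f u : linear (resY f u).
Proof.
move=> c v w; have [a fa] := laurent_order_ge f.
have [[b1 Yb1] [b2 Yb2]] := (vop_laurent X u v, vop_laurent X u w).
have Yv : order_ge (Num.min b1 b2) (Y u v).
  by apply: order_ge_le Yb1; rewrite ge_min lexx.
have Yw : order_ge (Num.min b1 b2) (Y u w).
  by apply: order_ge_le Yb2; rewrite ge_min lexx orbT.
move: (Num.min b1 b2) Yv Yw => b Yv Yw.
have YE : Y u (c *: v + w) = c *: Y u v + Y u w by rewrite linearP.
have Yh : order_ge b (Y u (c *: v + w)) by rewrite YE; exact: order_ge_lin.
pose M := (absz (- 1 - a - b)%R).+1.
have aM : - 1 - a - b < M%:Z by rewrite /M; lia.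
rewrite (resYE fa Yv aM) (resYE fa Yw aM) (resYE fa Yh aM) scaler_sumr -big_split.
apply: eq_bigr => k _ /=.
by rewrite YE !fctE scalerDr !scalerA mulrC.
Qed.
HB.instance Definition _ f u :=
  GRing.isLinear.Build F V V _ (resY f u) (resY_linear_right f u).

Lemma resY_linear_left f v : linear (fun u => resY f u v).
Proof.
move=> c u w; have [a fa] := laurent_order_ge f.
have [[b1 Yb1] [b2 Yb2]] := (vop_laurent X u v, vop_laurent X w v).
have Yu : order_ge (Num.min b1 b2) (Y u v).
  by apply: order_ge_le Yb1; rewrite ge_min lexx.
have Yw : order_ge (Num.min b1 b2) (Y w v).
  by apply: order_ge_le Yb2; rewrite ge_min lexx orbT.
move: (Num.min b1 b2) Yu Yw => b Yu Yw.
have YE : Y (c *: u + w) v = c *: Y u v + Y w v by rewrite linearPl.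
have Yh : order_ge b (Y (c *: u + w) v) by rewrite YE; exact: order_ge_lin.
pose M := (absz (- 1 - a - b)%R).+1.
have aM : - 1 - a - b < M%:Z by rewrite /M; lia.
rewrite (resYE fa Yu aM) (resYE fa Yw aM) (resYE fa Yh aM) scaler_sumr -big_split.
apply: eq_bigr => k _ /=.
by rewrite YE !fctE scalerDr !scalerA mulrC.
Qed.

Lemma resY0l f v : resY f 0 v = 0.
Proof.
by have := resY_linear_left f v (-1) 0 0; rewrite addr0 scaler0 scaleN1r addNr.
Qed.

Lemma resY_lX m u v : resY (lX F m) u v = Y u v (- 1 - m).
Proof.
have [b Yb] := vop_laurent X u v.
have [mb|bm] := ltP (- 1 - m) b.
  by rewrite (@resYE _ _ _ m b 0 (@order_ge_lX F m) Yb) ?big_ord0 ?Yb //; lia.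
rewrite (@resYE _ _ _ m b (absz (- 1 - m - b)%R).+1 (@order_ge_lX F m) Yb);
  last by lia.
rewrite big_ord_recr big1 /= => [|k _]; last first.
  by rewrite (_ : _ == m = false) ?scale0r //; have := ltn_ord k; lia.
rewrite add0r (_ : _ == m = true) ?scale1r; last by lia.
by congr (Y u v _); lia.
Qed.

Lemma resY_reg f u v a b : order_ge a f -> order_ge b (Y u v) -> 0 <= a + b ->
  resY f u v = 0.
Proof.
by move=> fa Yb ab; rewrite (@resYE f u v a b 0 fa Yb) ?big_ord0 //; lia.
Qed.

(** Maps that are linear and vanish on all series of large order.  Each identity
    between residues below is of this kind in each of its series, and hence
    needs to be checked for powers of x only, by [lin_cont_ext]. *)
Definition lin_cont (phi : L -> V) :=
  linear phi /\ exists N, forall f, order_ge N f -> phi f = 0.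

(** Operators on series that are linear and shift orders by a bounded amount. *)
Definition op_cont (T : L -> L) :=
  linear T /\ exists d, forall a f, order_ge a f -> order_ge (a + d) (T f).

Lemma lin_contB phi psi : lin_cont phi -> lin_cont psi ->
  lin_cont (fun f => phi f - psi f).
Proof.
move=> [phiL [N phi0]] [psiL [P psi0]]; split=> [c g h|].
  by rewrite phiL psiL scalerBr opprD addrACA.
exists (Num.max N P) => g gNP.
by rewrite phi0 ?psi0 ?subr0 //; apply: order_ge_le gNP; rewrite le_max lexx ?orbT.
Qed.

Lemma lin_cont_ext phi psi a : lin_cont phi -> lin_cont psi ->
  (forall m, a <= m -> phi (lX F m) = psi (lX F m)) ->
  forall f, order_ge a f -> phi f = psi f.
Proof.
move=> phiC psiC eqX f fa; have [subL sub0] := lin_contB phiC psiC.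
by apply: subr0_eq; apply: (laurent_ext subL sub0) fa => m am; rewrite eqX ?subrr.
Qed.

Lemma lin_cont0 : lin_cont (fun=> 0).
Proof. by split=> [c f g|]; [rewrite scaler0 addr0 | exists 0]. Qed.

Lemma lin_contZ (c : F) phi : lin_cont phi -> lin_cont (fun f => c *: phi f).
Proof.
move=> [phiL [N phi0]]; split=> [d f g|].
  by rewrite phiL scalerDr !scalerA mulrC.
by exists N => f /phi0->; rewrite scaler0.
Qed.

Lemma lin_cont_sum I (r : seq I) (phi : I -> L -> V) :
  (forall i, lin_cont (phi i)) -> lin_cont (fun f => \sum_(i <- r) phi i f).
Proof.
move=> phiC; elim: r => [|i r IH].
  by under [X in lin_cont X]eq_fun do rewrite big_nil; exact: lin_cont0.
have -> : (fun f => \sum_(j <- i :: r) phi j f) =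
    (fun f => phi i f - (- 1) *: \sum_(j <- r) phi j f).
  by apply/funext => f; rewrite big_cons scaleN1r opprK.
by apply: lin_contB => //; exact: lin_contZ.
Qed.

Lemma lin_cont_left f v (phi : L -> V) : lin_cont phi ->
  lin_cont (fun g => resY f (phi g) v).
Proof.
move=> [phiL [N phi0]]; split=> [c g h|]; first by rewrite phiL resY_linear_left.
by exists N => g /phi0->; rewrite resY0l.
Qed.

Lemma lin_cont_right f u (phi : L -> V) : lin_cont phi ->
  lin_cont (fun g => resY f u (phi g)).
Proof.
move=> [phiL [N phi0]]; split=> [c g h|]; first by rewrite phiL linearP.
by exists N => g /phi0->; rewrite linear0.
Qed.

Lemma lin_cont_resY T u v : op_cont T -> lin_cont (fun f => resY (T f) u v).
Proof.
move=> [TL [d Td]]; split=> [c f g|]; first by rewrite TL resY_linear_series.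
have [b Yb] := vop_laurent X u v; exists (- b - d) => f /Td Tf.
by apply: resY_reg Tf Yb _; lia.
Qed.

Lemma op_cont_id : op_cont id.
Proof. by split=> //; exists 0 => a f; rewrite addr0. Qed.
Lemma op_cont_comp T T' : op_cont T -> op_cont T' -> op_cont (T \o T').
Proof.
move=> [TL [d Td]] [TL' [d' Td']]; split=> [c f g|] /=; first by rewrite TL' TL.
by exists (d' + d) => a f /Td' /Td; rewrite addrA.
Qed.
Lemma op_cont_mull g : op_cont ( *%R g).
Proof.
split=> [c f h|]; first by rewrite mulrDr scalerAr.
by have [b gb] := laurent_order_ge g; exists b => a f fa; rewrite addrC;
  exact: lmul_order_geL.
Qed.
Lemma op_cont_mulr g : op_cont ( *%R^~ g).
Proof.
split=> [c f h|]; first by rewrite mulrDl scalerAl.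
by have [b gb] := laurent_order_ge g; exists b => a f fa; exact: lmul_order_geL.
Qed.
Lemma op_cont_hasse k : op_cont (@hasse F k).
Proof.
split=> [c f h|]; first by rewrite linearP.
by exists (- k%:Z) => a f; exact: hasse_order_ge.
Qed.
Lemma op_cont_lder : op_cont (@lder F).
Proof.
split=> [c f h|]; first by rewrite linearP.
by exists (- 1) => a f; exact: lder_order_ge.
Qed.
Lemma op_cont_lrefl : op_cont (@lrefl F).
Proof.
split=> [c f h|]; first by rewrite linearP.
by exists 0 => a f; rewrite addr0; exact: lrefl_order_ge.
Qed.

End Residues.

(** * Coefficients of the Jacobi identity *)

Section Jacobi.
Variables (F : numFieldType) (V : lmodType F) (X : weakQVA V).
Implicit Types (f g h : laurent F) (u v w : V).
Local Notation L := (laurent F).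
Local Notation Y := (vop X).
Local Notation lX := (lX F).
Local Notation K := (resY X).

Lemma subexpE (l : int) (k : nat) :
  subexp F l (l - k%:Z) k%:Z = (- 1) ^+ k * gbinom l%:~R k.
Proof. by rewrite /subexp subrK eqxx. Qed.

Lemma subexp_scale0 (l p q : int) (z : V) :
  (forall k : nat, q = k -> p = l - k%:Z -> z = 0) -> subexp F l p q *: z = 0.
Proof.
case: q => [k|k _]; last by rewrite scale0r.
move=> /(_ k erefl) zk; rewrite /subexp; case: eqP => [pk|];
  last by rewrite scale0r.
by rewrite zk ?scaler0 //; lia.
Qed.

(** Reflection of binomial coefficients: reverse the order of the k factors. *)
Lemma gbinom_neg (m : int) (k : nat) :
  (- 1) ^+ k * gbinom ((- 1 - m) + k%:Z)%:~R k = gbinom m%:~R k :> F.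
Proof.
rewrite /gbinom mulrA; congr (_ / _).
rewrite (reindex_inj rev_ord_inj) /= -[k in _ ^+ k](card_ord k)
  -prodr_const -big_split /=.
apply: eq_bigr => j _; rewrite natrB ?ltn_ord // rmorphD rmorphB /= rmorphN1.
by rewrite -natr1 pmulrn; ring.
Qed.

Lemma gbinom0 k : gbinom 0 k = (k == 0%N)%:R :> F.
Proof.
rewrite /gbinom; case: k => [|k]; first by rewrite big_ord0 divr1.
by rewrite big_ord_recl subrr mul0r mul0r.
Qed.

Lemma coef_prod12 u v w (l m n : int) (M : nat) :
  (forall k, (M <= k)%N -> K (lX (n + k%:Z)) v w = 0) ->
  fmul (@delta12 F) (prod12 Y u v w) (- 1 - l, - 1 - m, - 1 - n) =
  \sum_(k < M) ((- 1) ^+ k * gbinom l%:~R k) *: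
      K (lX (m + l - k%:Z)) u (K (lX (n + k%:Z)) v w).
Proof.
move=> v0; rewrite /fmul.
rewrite (@fsbig_range _ _ (fun k => (0, - 1 - m - l + k%:Z, - 1 - n - k%:Z)) M).
- apply: eq_bigr => k _ /=; rewrite !resY_lX -subexpE.
  by congr (subexp _ _ _ _ *: vop X _ (vop X _ _ _) _); lia.
- by move=> i j [] /addrI [].
case=> [[a' b'] c'] iN /=; case: eqP => [a'0|_]; last by rewrite scaler0.
apply: subexp_scale0 => k ck bk.
have [kM|Mk] := ltnP k M.
  by case: (iN k kM); congr (_, _, _); lia.
have := v0 k Mk; rewrite resY_lX (_ : - 1 - _ = c'); last by lia.
by move=> ->; rewrite linear0.
Qed.

Lemma coef_prod21 (s : seq (V * V)) w (l m n : int) (M : nat) :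
  (forall k p, (M <= k)%N -> p \in s -> K (lX (m + k%:Z)) p.1 w = 0) ->
  fmul (@delta21 F) (\sum_(p <- s) prod21 Y p.2 p.1 w) (- 1 - l, - 1 - m, - 1 - n) =
  \sum_(p <- s) \sum_(k < M) ((- 1) ^ l * ((- 1) ^+ k * gbinom l%:~R k)) *:
      K (lX (n + l - k%:Z)) p.2 (K (lX (m + k%:Z)) p.1 w).
Proof.
move=> p0; rewrite /fmul exchange_big /=.
rewrite (@fsbig_range _ _ (fun k => (0, - 1 - m - k%:Z, - 1 - n - l + k%:Z)) M).
- apply: eq_bigr => k _ /=; rewrite fct_sumE scaler_sumr; apply: eq_bigr => p _ /=.
  rewrite !resY_lX -subexpE.
  by congr (_ ^ _ * subexp _ _ _ _ *: vop X _ (vop X _ _ _) _); lia.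
- by move=> i j [] /addrI /oppr_inj [].
case=> [[a' b'] c'] iN /=; rewrite fct_sumE /=; case: eqP => [a'0|_]; last first.
  by rewrite big1 ?scaler0.
rewrite -scalerA subexp_scale0 ?scaler0 // => k bk ck.
have [kM|Mk] := ltnP k M.
  by case: (iN k kM); congr (_, _, _); lia.
rewrite big_seq big1 // => p ps.
have := p0 k p Mk ps; rewrite resY_lX (_ : - 1 - _ = b'); last by lia.
by move=> ->; rewrite linear0.
Qed.

Lemma coef_iter02 u v w (l m n : int) (M : nat) :
  (forall k, (M <= k)%N -> K (lX (l + k%:Z)) u v = 0) ->
  fmul (@delta10 F) (iter02 Y u v w) (- 1 - l, - 1 - m, - 1 - n) =
  \sum_(k < M) gbinom m%:~R k *: K (lX (m + n - k%:Z)) (K (lX (l + k%:Z)) u v) w.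
Proof.
move=> u0; rewrite /fmul.
rewrite (@fsbig_range _ _ (fun k => (- 1 - l - k%:Z, 0, - 1 - m - n + k%:Z)) M).
- apply: eq_bigr => k _ /=; rewrite !resY_lX -gbinom_neg -subexpE.
  by congr (subexp _ _ _ _ *: vop X (vop X _ _ _) _ _); lia.
- by move=> i j [] /addrI /oppr_inj [].
case=> [[a' b'] c'] iN /=; case: eqP => [b'0|_]; last by rewrite scaler0.
apply: subexp_scale0 => k ak ck.
have [kM|Mk] := ltnP k M.
  by case: (iN k kM); congr (_, _, _); lia.
have := u0 k Mk; rewrite resY_lX (_ : - 1 - _ = a'); last by lia.
by move=> ->; rewrite linear0l.
Qed.

(** The Jacobi identity at the coefficient of x0^(-l-1) x1^(-m-1) x2^(-n-1).
    The bounds of the three sums are independent of each other because the uses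
    need them to be uniform in different exponents. *)
Lemma borcherds u v : exists s : seq (V * V), forall w (l m n : int)
  (M1 M2 M3 : nat),
  (forall k, (M1 <= k)%N -> K (lX (n + k%:Z)) v w = 0) ->
  (forall k p, (M2 <= k)%N -> p \in s -> K (lX (m + k%:Z)) p.1 w = 0) ->
  (forall k, (M3 <= k)%N -> K (lX (l + k%:Z)) u v = 0) ->
  \sum_(k < M1) ((- 1) ^+ k * gbinom l%:~R k) *:
      K (lX (m + l - k%:Z)) u (K (lX (n + k%:Z)) v w)
  - \sum_(p <- s) \sum_(k < M2) ((- 1) ^ l * ((- 1) ^+ k * gbinom l%:~R k)) *:
      K (lX (n + l - k%:Z)) p.2 (K (lX (m + k%:Z)) p.1 w)
  = \sum_(k < M3) gbinom m%:~R k *: K (lX (m + n - k%:Z)) (K (lX (l + k%:Z)) u v) w.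
Proof.
have [s sJ] := vop_jacobi X u v; exists s => w l m n M1 M2 M3 v0 p0 u0.
have := congr1 (fun G => G (- 1 - l, - 1 - m, - 1 - n)) (sJ w).
by rewrite -(coef_prod12 u l m v0) -(coef_prod21 l n p0) -(coef_iter02 w m n u0).
Qed.

Lemma resY_tail u v (a : int) : exists M : nat,
  forall (k : nat) m, a <= m -> (M <= k)%N -> K (lX (m + k%:Z)) u v = 0.
Proof.
have [b Yb] := vop_laurent X u v; exists (absz (b + a)%R) => k m am Mk.
by rewrite resY_lX Yb //; lia.
Qed.

Lemma resY_tail_seq (s : seq (V * V)) w (a : int) : exists M : nat,
  forall (k : nat) p, (M <= k)%N -> p \in s -> K (lX (a + k%:Z)) p.1 w = 0.
Proof.
elim: s => [|q s [M IH]]; first by exists 0%N.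
have [P Pq] := resY_tail q.1 w a; exists (maxn M P) => k p.
rewrite geq_max inE => /andP[Mk Pk] /predU1P[->|]; [exact: Pq | exact: IH].
Qed.

End Jacobi.

(** * Commutator and iterate formulas for Laurent kernels *)

Section Calculus.
Variables (F : numFieldType) (V : lmodType F) (X : weakQVA V).
Implicit Types (f g h : laurent F) (u v w : V).
Local Notation L := (laurent F).
Local Notation Y := (vop X).
Local Notation lX := (lX F).
Local Notation K := (resY X).

Lemma resYZ (c : F) f u v : K (c *: f) u v = c *: K f u v.
Proof.
have K0 : K 0 u v = 0.
  by have := resY_linear_series X u v (-1) 0 0;
    rewrite scaler0 addr0 scaleN1r addNr.
by have := resY_linear_series X u v c f 0; rewrite K0 !addr0.
Qed.

Lemma sum_gbinom0 (c : nat -> F) (z : nat -> V) (M : nat) :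
  \sum_(k < M.+1) (c k * gbinom 0%:~R k) *: z k = c 0%N *: z 0%N.
Proof.
rewrite big_ord_recl big1 => [|k _]; first by rewrite gbinom0 mulr1 addr0.
by rewrite gbinom0 mulr0 scale0r.
Qed.

(** Jacobi at l = 0, where (x1 - x2)^l = 1 leaves one term in each of the first
    two sums. *)
Lemma commutator u v : exists s : seq (V * V), exists M : nat, forall w f g,
  K f u (K g v w) - \sum_(p <- s) K g p.2 (K f p.1 w) =
  \sum_(k < M) K (g * hasse k f) (K (lX k%:Z) u v) w.
Proof.
have [s sB] := borcherds X u v; have [M uv0] := resY_tail X u v 0.
exists s, M => w f g.
have [[a fa] [b gb]] := (laurent_order_ge f, laurent_order_ge g).
pose lhs f g := K f u (K g v w) - \sum_(p <- s) K g p.2 (K f p.1 w).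
pose rhs f g := \sum_(k < M) K (g * hasse k f) (K (lX k%:Z) u v) w.
apply: (@lin_cont_ext _ _ (lhs^~ g) (rhs^~ g) a) fa => [||m _].
- apply: lin_contB; first apply/lin_cont_resY/op_cont_id.
  by apply: lin_cont_sum => p; apply: lin_cont_right;
    apply/lin_cont_resY/op_cont_id.
- apply: lin_cont_sum => k; apply: lin_cont_resY.
  exact: (op_cont_comp (op_cont_mull g) (op_cont_hasse F k)).
apply: (@lin_cont_ext _ _ (lhs (lX m)) (rhs (lX m)) b) gb => [||n _].
- apply: lin_contB; first by apply: lin_cont_right; apply/lin_cont_resY/op_cont_id.
  by apply: lin_cont_sum => p; apply/lin_cont_resY/op_cont_id.
- by apply: lin_cont_sum => k; exact/lin_cont_resY/op_cont_mulr.
have [M1 vw0] := resY_tail X v w n; have [M2 sw0] := resY_tail_seq X s w m.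
(* The ranges are nonempty, so that the term k = 0 is there to survive. *)
have := sB w 0 m n M1.+1 M2.+1 M.
rewrite /lhs /rhs.
move=> /(_ (fun k kM => vw0 k n (lexx n) (ltnW kM))).
move=> /(_ (fun k p kM => sw0 k p (ltnW kM))).
move=> /(_ (fun k kM => uv0 k 0 (lexx 0) kM)) sBE.
transitivity (\sum_(k < M) gbinom m%:~R k *:
    K (lX (m + n - k%:Z)) (K (lX (0 + k%:Z)) u v) w); last first.
  apply: eq_bigr => k _; rewrite hasse_lX -scalerAr lXD resYZ add0r.
  by rewrite (_ : n + (m - k%:Z) = m + n - k%:Z); last by lia.
rewrite -sBE; congr (_ - _).
  by rewrite (sum_gbinom0 (fun k => (-1) ^+ k)
    (fun k => K (lX (m + 0 - k%:Z)) u (K (lX (n + k%:Z)) v w))) scale1r !addr0.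
apply: eq_bigr => p _; rewrite expr0z.
under eq_bigr do rewrite mul1r.
by rewrite (sum_gbinom0 (fun k => (-1) ^+ k)
  (fun k => K (lX (n + 0 - k%:Z)) p.2 (K (lX (m + k%:Z)) p.1 w))) scale1r !addr0.
Qed.

(** Jacobi at m = 0.  The two sums over k are the expansions of f(x1 - x2) in
    powers of x2 and of x1; the second one is the expansion of f(- y) at y = x2 - x1.
    The bound on the order of g is what makes M0 uniform in g. *)
Lemma iterate u v : exists s : seq (V * V), forall w a, exists M0 : nat,
  forall (M : nat) f g, (M0 <= M)%N -> order_ge a g ->
  K g (K f u v) w =
  \sum_(k < M) (- 1) ^+ k *: K (hasse k f) u (K (lX k%:Z * g) v w)
  - \sum_(p <- s) \sum_(k < M)
      (- 1) ^+ k *: K (g * hasse k (lrefl f)) p.2 (K (lX k%:Z) p.1 w).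
Proof.
have [s sB] := borcherds X u v; exists s => w b.
have [M1 vw0] := resY_tail X v w b; have [M2 sw0] := resY_tail_seq X s w 0.
exists (maxn M1 M2) => M f g; rewrite geq_max => /andP[M1M M2M] gb.
have [a fa] := laurent_order_ge f.
pose lhs f g := K g (K f u v) w.
pose rhs f g := \sum_(k < M) (- 1) ^+ k *: K (hasse k f) u (K (lX k%:Z * g) v w)
  - \sum_(p <- s) \sum_(k < M)
      (- 1) ^+ k *: K (g * hasse k (lrefl f)) p.2 (K (lX k%:Z) p.1 w).
apply: (@lin_cont_ext _ _ (lhs^~ g) (rhs^~ g) a) fa => [||l _].
- by apply/lin_cont_left/lin_cont_resY/op_cont_id.
- apply: lin_contB.
    by apply: lin_cont_sum => k; apply/lin_contZ/lin_cont_resY/op_cont_hasse.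
  apply: lin_cont_sum => p; apply: lin_cont_sum => k; apply/lin_contZ/lin_cont_resY.
  apply: (op_cont_comp (op_cont_mull g)).
  exact: (op_cont_comp (op_cont_hasse F k) (op_cont_lrefl F)).
apply: (@lin_cont_ext _ _ (lhs (lX l)) (rhs (lX l)) b) gb => [||n bn].
- by apply/lin_cont_resY/op_cont_id.
- apply: lin_contB.
    by apply: lin_cont_sum => k; apply/lin_contZ/lin_cont_right/lin_cont_resY/op_cont_mull.
  by apply: lin_cont_sum => p; apply: lin_cont_sum => k;
    apply/lin_contZ/lin_cont_resY/op_cont_mulr.
have [M3 uv0] := resY_tail X u v l.
have := sB w l 0 n M M M3.+1.
move=> /(_ (fun k kM => vw0 k n bn (leq_trans M1M kM))).
move=> /(_ (fun k p kM => sw0 k p (leq_trans M2M kM))).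
move=> /(_ (fun k kM => uv0 k l (lexx l) (ltnW kM))).
under [X in _ = X -> _]eq_bigr do rewrite -[gbinom _ _]mul1r.
rewrite (sum_gbinom0 (fun=> 1)
  (fun k => K (lX (0 + n - k%:Z)) (K (lX (l + k%:Z)) u v) w)).
rewrite scale1r subr0 !addr0 !add0r /lhs /rhs => <-; congr (_ - _).
  apply: eq_bigr => k _; rewrite hasse_lX resYZ lXD scalerA.
  by rewrite (addrC n).
apply: eq_bigr => p _; apply: eq_bigr => k _.
rewrite lrefl_lX linearZ /= hasse_lX scalerA -scalerAr lXD resYZ scalerA add0r.
by rewrite addrA mulrCA.
Qed.

Lemma resY_vac k u : 0 <= k -> K (lX k) u (vac X) = 0.
Proof. by move=> k0; rewrite resY_lX vop_vacr //; lia. Qed.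

Lemma resY_creation u : K (lX (- 1)) u (vac X) = u.
Proof. by rewrite resY_lX -[RHS](vop_creation X) //; congr (Y _ _ _). Qed.

Lemma resY_Dop u : K (lX (- 2)) u (vac X) = Dop X u.
Proof. by rewrite resY_lX /Dop /mode; congr (Y _ _ _). Qed.

Lemma resY_vacl k w : K (lX k) (vac X) w = if k == - 1 then w else 0.
Proof. by rewrite resY_lX vop_vacl; congr (if _ then _ else _); lia. Qed.

(** [iterate] with g = x^(-2), applied to the vacuum: creation kills the terms
    in the opposite order and all but two of the others. *)
Lemma Dop_resY f u v : Dop X (K f u v) = K f u (Dop X v) - K (lder f) u v.
Proof.
have [s sI] := iterate u v; have [M0 sIM] := sI (vac X) (- 2).
rewrite -resY_Dop (sIM (maxn M0 2) f _ (leq_maxl _ _) (@order_ge_lX F (- 2))).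
have : (2 <= maxn M0 2)%N by rewrite leq_maxr.
case: (maxn M0 2) => [|[|M _]] //.
rewrite [X in _ - X]big1 ?subr0 => [|p _]; last first.
  by rewrite big1 // => k _; rewrite resY_vac // linear0 scaler0.
rewrite !big_ord_recl big1 ?addr0 => [|k _]; last first.
  by rewrite lXD resY_vac ?linear0 ?scaler0 //= /bump /=; lia.
rewrite !lXD hasse0 hasse1 expr0 expr1 scale1r scaleN1r /=.
by rewrite resY_Dop resY_creation.
Qed.

Lemma gbinom_minus2 (k : nat) : (- 1) ^+ k * gbinom (- 2) k = k.+1%:R :> F.
Proof.
elim: k => [|k IH]; first by rewrite /gbinom big_ord0 divr1 mul1r.
have k0 : k.+1%:R != 0 :> F by rewrite pnatr_eq0.
have -> : gbinom (- 2) k.+1 = gbinom (- 2) k * (- 2 - k%:R) / k.+1%:R :> F.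
  by rewrite /gbinom big_ord_recr /= factS natrM invfM; ring.
transitivity ((- 1) ^+ k * gbinom (- 2) k * k.+2%:R / k.+1%:R :> F).
  by rewrite exprS -[k.+2]/(2 + k)%N natrD; ring.
by rewrite IH mulrAC divff // mul1r.
Qed.

(** Jacobi for the pair (u, 1), whose opposite-order terms are unknown: the
    exponent p of x1 is taken so large that they vanish, and the exponent
    n - p of x2 compensates. *)
Lemma resY_DopX (n : int) u w :
  K (lX n) (Dop X u) w = - (n%:~R *: K (lX (n - 1)) u w).
Proof.
have [s sB] := borcherds X u (vac X).
have [M2 sw0] := resY_tail_seq X s w 0.
have [p [k0 [k0E pM]]] :
    exists (p : int) (k0 : nat), p - n = k0%:Z + 1 /\ M2%:Z <= p.
  pose p : int := (M2 + absz n + 1)%N.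
  by exists p, (absz (p - n - 1)%R); rewrite /p; lia.
(* Against the vacuum on the right only k = k0 survives, as n - p + k0 = - 1. *)
have H1 k : (k0.+1 <= k)%N -> K (lX (n - p + k%:Z)) (vac X) w = 0.
  by move=> k0k; rewrite resY_vacl ifF //; lia.
have H2 k q : (0 <= k)%N -> q \in s -> K (lX (p + k%:Z)) q.1 w = 0.
  move=> _ qs; rewrite (_ : p + k%:Z = 0 + (absz (p + k%:Z)%R)%:Z); last by lia.
  by apply: sw0 => //; lia.
have H3 k : (2 <= k)%N -> K (lX (- 2 + k%:Z)) u (vac X) = 0.
  by move=> k2; rewrite resY_vac //; lia.
have := sB w (- 2) p (n - p) _ _ _ H1 H2 H3.
rewrite [X in _ - X]big1 => [|q _]; last by rewrite big_ord0.
rewrite subr0 big_ord_recr big1 => [|k _]; last first.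
  by rewrite resY_vacl ifF ?linear0 ?scaler0 //; have /= := ltn_ord k; lia.
rewrite /= add0r resY_vacl ifT; last by lia.
rewrite mulrNz gbinom_minus2 !big_ord_recl big_ord0 addr0 /=.
rewrite /gbinom big_ord0 big_ord1 !divr1 subr0 scale1r !addr0.
rewrite resY_Dop (_ : - 2 + _ = - 1) // resY_creation.
have -> : p - 2 - k0%:Z = n - 1 by lia.
have -> : p + (n - p) = n by lia.
move=> /eqP; rewrite -subr_eq => /eqP <-; rewrite -scalerBl -scaleNr.
have -> : k0.+1%:R = p%:~R - n%:~R :> F by rewrite -rmorphB k0E -PoszD addn1.
by congr (_ *: _); rewrite subr0; ring.
Qed.

Lemma resY_Dopl f u w : K f (Dop X u) w = - K (lder f) u w.
Proof.
have [a fa] := laurent_order_ge f; rewrite -scaleN1r.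
apply: (@lin_cont_ext _ _ (fun f => K f (Dop X u) w)
  (fun f => - 1 *: K (lder f) u w) a) fa => [||m _].
- by apply/lin_cont_resY/op_cont_id.
- by apply/lin_contZ/lin_cont_resY/op_cont_lder.
by rewrite resY_DopX lder_lX resYZ scaleN1r.
Qed.

End Calculus.

(** * Algebra structure on a quotient *)

Section QuotientAlgebra.
Variables (F : fieldType) (V : lmodType F) (A : set V) (mul : V -> V -> V).

Lemma mem_lspan v : A v -> v \in lspan A.
Proof.
move=> Av; apply/asboolP; exists [:: (1, v)]; split=> [p|];
  first by rewrite inE => /eqP->.
by rewrite big_seq1 scale1r.
Qed.

Lemma lspan_ind (phi : V -> V) : linear phi ->
  (forall v, A v -> phi v \in lspan A) ->
  forall v, v \in lspan A -> phi v \in lspan A.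
Proof.
move=> phiL phiA v /asboolP[s [sA ->]]; elim: s sA => [|p s IH] sA.
  have := phiL (- 1) 0 0; rewrite big_nil scaler0 addr0 scaleN1r addNr => ->.
  exact: rpred0.
rewrite big_cons phiL; apply: rpredD.
  by rewrite rpredZ //; apply/phiA/sA/mem_head.
by apply: IH => q qs; apply: sA; rewrite inE qs orbT.
Qed.

Lemma quotient_algebra : bilinear_for *:%R *:%R mul ->
  two_sided_ideal mul (lspan A) ->
  (forall a b c, mul (mul a b) c - mul a (mul b c) \in lspan A) ->
  exists mulq : lquot A -> lquot A -> lquot A,
    [/\ bilinear_for *:%R *:%R mulq,
        forall u v, mulq (lproj A u) (lproj A v) = lproj A (mul u v)
      & associative mulq].
Proof.
move=> [mulDl mulDr] [_ ideal] massoc.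
pose sec (x : lquot A) : V := projT1 (cid (lproj_surj x)).
have secK x : lproj A (sec x) = x by rewrite -(projT2 (cid (lproj_surj x))).
have mulE u v : lproj A (mul (sec (lproj A u)) (sec (lproj A v))) =
  lproj A (mul u v).
  set u' := sec _; set v' := sec _.
  have uu' : u' - u \in lspan A by rewrite -lproj_eq secK.
  have vv' : v' - v \in lspan A by rewrite -lproj_eq secK.
  apply/eqP; rewrite lproj_eq.
  have -> : mul u' v' - mul u v = mul (u' - u) v' + mul u (v' - v).
    have -> : mul (u' - u) v' = mul u' v' - mul u v'.
      by have := mulDl v' (- 1) u u'; rewrite /= !scaleN1r ![- _ + _]addrC.
    have -> : mul u (v' - v) = mul u v' - mul u v.
      by have := mulDr u (- 1) v v'; rewrite /= !scaleN1r ![- _ + _]addrC.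
    by rewrite addrA subrK.
  by rewrite rpredD //; [have [] := ideal v' _ uu' | have [] := ideal u _ vv'].
have lin c x y : c *: lproj A x + lproj A y =
  lproj A (c *: x + y) by rewrite linearP.
exists (fun x y => lproj A (mul (sec x) (sec y))); split=> //.
- split=> [z c x y | z c x y] /=; rewrite -(secK x) -(secK y) -(secK z);
    rewrite lin !mulE lin.
    by rewrite -mulDl.
  by rewrite -mulDr.
- move=> x y z; rewrite -(secK x) -(secK y) -(secK z) !mulE; apply/esym/eqP.
  by rewrite lproj_eq !secK; exact: massoc.
Qed.

End QuotientAlgebra.

(** * The ideal and the associativity of the product *)

Section ZhuAlgebra.
Variables (F : numFieldType) (V : lmodType F) (X : weakQVA V) (n : nat).
Implicit Types (f g h : laurent F) (u v w : V) (P Q : {poly F}).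
Local Notation L := (laurent F).
Local Notation K := (resY X).
Local Notation O := (lspan (Ogen X n)).

Lemma resY_sum (m : nat) (c : 'I_m -> F) (f : 'I_m -> L) u v :
  K (\sum_(i < m) c i *: f i) u v = \sum_(i < m) c i *: K (f i) u v.
Proof.
rewrite (big_morph (fun f => K f u v) (id1 := 0) (op1 := +%R)) => [|g h|].
- by apply: eq_bigr => i _; rewrite resYZ.
- by rewrite -[g]scale1r resY_linear_series !scale1r.
- by rewrite -[0 in LHS](scale0r 0) resYZ scale0r.
Qed.

Lemma linv_lpow k : linv (lpow (lexp 1 - lone F) k) = (bern F ^+ k : L).
Proof.
have -> : lpow (lexp 1 - lone F) k = ((lexpL 1 - 1) ^+ k : L).
  by elim: k => // k IH; rewrite exprS /lpow iterS -/(lpow _ k) IH.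
have bk : (lexpL 1 - 1) ^+ k * bern F ^+ k = 1 :> L by rewrite -exprMn bernP expr1n.
apply: xget_unique => [|g [[a ga] fg1]].
  by split; [have [a ba] := laurent_order_ge (bern F ^+ k);
    exists a | rewrite -lcoefM bk].
have gL : g \in @lser F by apply/lserP; exists a.
have fg : (lexpL 1 - 1) ^+ k * Laurent gL = 1 :> L by apply/val_inj.
rewrite -[g]/(lcoef (Laurent gL)) -[Laurent gL]mulr1 -bk mulrA.
by rewrite [Laurent gL * _]mulrC fg mul1r.
Qed.

Lemma kernE k : kern F n (k + n.+1)%N = bpoly ((1 + 'X) ^+ n.+1 * 'X ^+ k)
  :> (int -> F).
Proof.
rewrite /kern linv_lpow -[lexp _]/(lcoef (lexpL _)) -lcoefM lexp_nat; congr lcoef.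
rewrite addnC exprD mulrA -exprMn lexp_bern /bpoly.
by rewrite !(rmorphM, rmorphXn, rmorphD, rmorph1) /= horner_algX.
Qed.

(** The binomial series of (1 + w)^(-n-1), truncated at degree n. *)
Definition trunc_binom : {poly F} :=
  \sum_(i < n.+1) gbinom (- n.+1%:R) i *: 'X ^+ i.
(** Evaluated at w, this and [circ_poly] are the kernels of the two products. *)
Definition star_poly : {poly F} := (1 + 'X) ^+ n.+1 * trunc_binom.
Definition circ_poly : {poly F} := ('X * (1 + 'X)) ^+ n.+1.

Lemma starE u v : star X n u v = K (bpoly star_poly) u v.
Proof.
rewrite /star /Res fct_sumE.
transitivity (K (\sum_(i < n.+1) gbinom (- n.+1%:R) i *:
    bpoly ((1 + 'X) ^+ n.+1 * 'X ^+ i)) u v).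
  rewrite resY_sum; apply: eq_bigr => i _; rewrite fctE; congr (_ *: _).
  by rewrite /resY /Res -kernE -addnA addn1.
rewrite -bpoly_sum /star_poly /trunc_binom mulr_sumr; congr (K (bpoly _) u v).
by apply: eq_bigr => i _; rewrite -scalerAr.
Qed.

Lemma circE u v : circ X n u v = K (bpoly circ_poly) u v.
Proof.
rewrite /circ /resY; congr (Res (fmul _ _)).
by rewrite (_ : (2 * n + 2)%N = (n.+1 + n.+1)%N)
  ?kernE ?/circ_poly ?exprMn 1?mulrC //; lia.
Qed.

Lemma gbinomS (a : F) m : m.+1%:R * gbinom a m.+1 = (a - m%:R) * gbinom a m.
Proof.
have m0 : m.+1%:R != 0 :> F by rewrite pnatr_eq0.
have f0 : m`!%:R != 0 :> F by rewrite pnatr_eq0 -lt0n fact_gt0.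
rewrite /gbinom big_ord_recr /= factS natrM; move: (m.+1%:R) m0 => q q0.
by field; rewrite q0 f0.
Qed.

(** The binomial series P of (1 + X)^(-n-1) solves (1 + X) P' = - (n + 1) P;
    truncation at degree m leaves an error in degree m only. *)
Lemma trunc_binomial_deriv m :
  let P := \sum_(i < m.+1) gbinom (- n.+1%:R) i *: 'X ^+ i : {poly F} in
  P *+ n.+1 + (1 + 'X) * P^`() = ((n.+1 + m)%:R * gbinom (- n.+1%:R) m) *: 'X^m.
Proof.
move=> /=; elim: m => [|m IH].
  rewrite big_ord1 expr0 derivZ derivC scaler0 mulr0 !addr0 addn0.
  by rewrite -scalerA scaler_nat.
rewrite big_ord_recr /= mulrnDl derivD mulrDr addrACA IH derivZ derivXn /=.
have : m.+1%:R * gbinom (- n.+1%:R) m.+1 =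
  - ((n.+1 + m)%:R * gbinom (- n.+1%:R) m) :> F.
  by rewrite gbinomS natrD; ring.
move: (gbinom _ m) (gbinom _ m.+1) => t t' /eqP; rewrite -addr_eq0 => /eqP tE.
rewrite -!mul_polyC polyCM polyC_natr exprS natrD.
have : m.+1%:R * t'%:P + (n.+1 + m)%:R * t%:P = 0 :> {poly F}.
  by rewrite -!polyC_natr -!polyCM -polyCD tE.
rewrite natrD => {}tE.
transitivity (((n.+1%:R + m%:R) * t%:P + m.+1%:R * t'%:P) * 'X^m +
   (n.+1%:R + m.+1%:R) * t'%:P * ('X * 'X^m) : {poly F}); first by ring.
rewrite [X in X * _ + _]addrC tE mul0r add0r.
by rewrite polyCM polyC_natr natrD.
Qed.

Lemma star_poly_deriv : exists c, star_poly^`() = c *: ('X * (1 + 'X)) ^+ n.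
Proof.
exists ((n.+1 + n)%:R * gbinom (- n.+1%:R) n).
rewrite /star_poly derivM deriv_exp derivD derivX derivC add0r mul1r /=.
have -> : (1 + 'X) ^+ n *+ n.+1 * trunc_binom + (1 + 'X) ^+ n.+1 * trunc_binom^`() =
  (1 + 'X) ^+ n * (trunc_binom *+ n.+1 + (1 + 'X) * trunc_binom^`()).
  by rewrite exprS; ring.
by rewrite trunc_binomial_deriv -scalerAr exprMn [_ * 'X^n]mulrC.
Qed.

Definition null_kernel f := forall u v, K f u v \in O.

Lemma Dop_mem v : Dop X v \in O.
Proof. by apply: mem_lspan; left; exists v. Qed.

Lemma circ_null : null_kernel (bpoly circ_poly).
Proof. by move=> u v; rewrite -circE; apply: mem_lspan; right; exists u, v. Qed.

(** Solve D K_f(u, v) = K_f(u, D v) - K_df(u, v) for the last term, df being the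
    derivative of f. *)
Lemma lder_null f : null_kernel f -> null_kernel (lder f).
Proof.
move=> fO u v.
have -> : K (lder f) u v = K f u (Dop X v) - Dop X (K f u v)
  by rewrite Dop_resY subKr.
by rewrite rpredB ?Dop_mem.
Qed.

Lemma lder_circ_poly m : lder (bpoly (circ_poly * 'X^m)) =
  - (n.+1 + n.+1 + m)%:R *: bpoly (circ_poly * 'X^(m.+1))
    - (n.+1 + m)%:R *: bpoly (circ_poly * 'X^m).
Proof.
rewrite lder_bpoly -!bpolyZ /bpoly -rmorphB; congr (horner_alg _ _).
rewrite derivM /circ_poly deriv_exp derivM derivD derivX derivC add0r mul1r mulr1
  derivXn /=.
rewrite scaleNr !scaler_nat mulrDr.
have -> : - 'X * (1 + 'X) * (('X * (1 + 'X)) ^+ n.+1 * ('X^(m.-1) *+ m)) =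
    - (1 + 'X) * ('X * (1 + 'X)) ^+ n.+1 * ('X^m *+ m) :> {poly F}.
  case: m => [|m]; first by rewrite !mulr0n !mulr0.
  by rewrite (exprS _ m) /=; ring.
by rewrite !(exprS _ n) (exprS _ m); ring.
Qed.

(** Induction on m for P = X^m: [lder_circ_poly] expresses the kernel for m + 1
    by that for m and its derivative, with the coefficient 2n + 2 + m, which is
    invertible in characteristic 0. *)
Lemma circ_ideal_null P : null_kernel (bpoly (circ_poly * P)).
Proof.
have BX m : null_kernel (bpoly (circ_poly * 'X^m)).
  elim: m => [|m IH]; first by rewrite expr0 mulr1; exact: circ_null.
  have c0 : (n.+1 + n.+1 + m)%:R != 0 :> F by rewrite pnatr_eq0.
  move=> u v; rewrite -[bpoly _]scale1r -(mulVf c0) -scalerA resYZ rpredZ //.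
  have -> : (n.+1 + n.+1 + m)%:R *: bpoly (circ_poly * 'X^(m.+1)) =
    (- 1) *: lder (bpoly (circ_poly * 'X^m)) + (- (n.+1 + m)%:R)
      *: bpoly (circ_poly * 'X^m).
    by rewrite lder_circ_poly !scaleN1r scaleNr opprB scaleNr opprK addrAC subrr
      add0r.
  rewrite resY_linear_series resYZ; apply: rpredD; apply: rpredZ; last exact: IH.
  exact: lder_null.
move=> u v; rewrite -[P]coefK poly_def mulr_sumr.
under eq_bigr do rewrite -scalerAr.
by rewrite bpoly_sum resY_sum rpred_sum // => i _; rewrite rpredZ ?BX.
Qed.

(** The ideal of F[w] generated by (w (1 + w))^(n+1). *)
Definition in_ideal f := exists P, f = bpoly (circ_poly * P).

Lemma in_ideal_null f : in_ideal f -> null_kernel f.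
Proof. by case=> P ->; exact: circ_ideal_null. Qed.

Lemma in_idealM P f : in_ideal f -> in_ideal (bpoly P * f).
Proof. by case=> Q ->; exists (P * Q); rewrite -bpolyM mulrCA. Qed.

Lemma in_idealZ c f : in_ideal f -> in_ideal (c *: f).
Proof. by case=> Q ->; exists (c *: Q); rewrite -scalerAr bpolyZ. Qed.

Lemma in_ideal_lder f : in_ideal f -> in_ideal (lder f).
Proof.
case=> P ->; rewrite lder_bpoly derivM.
exists (- 'X * (1 + 'X) * P^`() - (1 + 'X *+ 2) *+ n.+1 * P); congr bpoly.
rewrite /circ_poly deriv_exp derivM derivD derivX derivC add0r mul1r mulr1.
by rewrite exprS /=; ring.
Qed.

Lemma in_ideal_lrefl f : in_ideal f -> in_ideal (lrefl f).
Proof.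
case=> P ->; rewrite lrefl_bpoly comp_polyM; exists (P \Po (- 1 - 'X)).
congr (bpoly (_ * _)); rewrite /circ_poly rmorphXn /= comp_polyM comp_polyD
  comp_polyX.
by rewrite -[1 \Po _]/(1%:P \Po _) comp_polyC; congr (_ ^+ _); rewrite polyC1; ring.
Qed.

Lemma in_ideal_hasse k f : in_ideal f -> in_ideal (hasse k f).
Proof. by move=> fB; apply: in_idealZ; elim: k => //= k; exact: in_ideal_lder. Qed.

Lemma in_ideal_hasseS k f : in_ideal (lder f) -> in_ideal (hasse k.+1 f).
Proof.
move=> fB; apply: in_idealZ; rewrite iterSr.
by elim: k => //= k; exact: in_ideal_lder.
Qed.

Lemma bpoly_hasse k P : exists Q, hasse k (bpoly P) = bpoly Q.
Proof.
rewrite /hasse; have [Q ->] : exists Q, iter k (@lder F) (bpoly P) = bpoly Q.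
  elim: k => [|k [Q IH]]; first by exists P.
  by rewrite iterS IH lder_bpoly; eexists.
by exists (k`!%:R^-1 *: Q); rewrite bpolyZ.
Qed.

Lemma lder_star_poly : in_ideal (lder (bpoly star_poly)).
Proof.
have [c Sc] := star_poly_deriv; exists (- c%:P); rewrite lder_bpoly Sc -mul_polyC.
by congr bpoly; rewrite /circ_poly exprS; ring.
Qed.

(** For k = 0: s(x) contains the factor (1 + w)^(n+1) and s(- x) the factor
    w^(n+1).  For larger k the derivative of s(- x) is already in the ideal. *)
Lemma star_poly_orthogonal k :
  in_ideal (bpoly star_poly * hasse k (lrefl (bpoly star_poly))).
Proof.
case: k => [|k]; last first.
  apply/in_idealM/in_ideal_hasseS; rewrite lder_lrefl -scaleN1r.
  exact/in_idealZ/in_ideal_lrefl/lder_star_poly.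
rewrite hasse0 lrefl_bpoly -bpolyM.
exists ((- 1) ^+ n.+1 * trunc_binom * (trunc_binom \Po (- 1 - 'X))); congr bpoly.
rewrite /star_poly comp_polyM rmorphXn /= comp_polyD comp_polyX.
rewrite -[1 \Po _]/(1%:P \Po _) comp_polyC polyC1.
by rewrite (_ : 1 + (- 1 - 'X) = - 1 * 'X) ?exprMn /circ_poly ?exprMn; ring.
Qed.

Lemma star_bilinear : bilinear_for *:%R *:%R (star X n).
Proof.
split=> [v c a b | u c a b] /=; rewrite !starE; first by rewrite resY_linear_left.
by rewrite linearP.
Qed.

Lemma star_ideal : two_sided_ideal (star X n) O.
Proof.
split; first exact: lspan_submod_closed.
move=> u v vO; rewrite !starE; split.
  apply: lspan_ind vO => [c a b|_ [[b _ <-]|[a [b ->]]]]; first by rewrite linearP.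
    have -> : K (bpoly star_poly) u (Dop X b) =
      Dop X (K (bpoly star_poly) u b) + K (lder (bpoly star_poly)) u b.
      by rewrite Dop_resY subrK.
    by rewrite rpredD ?Dop_mem ?(in_ideal_null lder_star_poly).
  rewrite circE; have [s [M uaE]] := commutator X u a.
  rewrite -[K _ u _](subrK
    (\sum_(p <- s) K (bpoly circ_poly) p.2 (K (bpoly star_poly) p.1 b))) uaE.
  rewrite rpredD ?rpred_sum // => [k _|p _]; last exact: circ_null.
  have [Q ->] := bpoly_hasse k star_poly; apply: in_ideal_null; rewrite mulrC.
  by apply: in_idealM; exists 1; rewrite mulr1.
apply: (@lspan_ind _ _ _ (fun v => K (bpoly star_poly) v u)) vO =>
  [c a b|_ [[b _ <-]|[a [b ->]]]].
- exact: resY_linear_left.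
- by rewrite resY_Dopl rpredN (in_ideal_null lder_star_poly).
have inBB : in_ideal (bpoly circ_poly) by exists 1; rewrite mulr1.
rewrite circE; have [s sI] := iterate X a b.
have [c Sc] := laurent_order_ge (bpoly star_poly); have [M sIM] := sI u c.
rewrite (sIM M _ _ (leqnn M) Sc) rpredB ?rpred_sum // => [k _|p _].
  by rewrite rpredZ // (in_ideal_null (in_ideal_hasse k inBB)).
rewrite rpred_sum // => k _; rewrite rpredZ //.
by apply: in_ideal_null; exact/in_idealM/in_ideal_hasse/in_ideal_lrefl.
Qed.

Lemma star_assoc a b c :
  star X n (star X n a b) c - star X n a (star X n b c) \in O.
Proof.
rewrite !starE; have [s sI] := iterate X a b.
have [d Sd] := laurent_order_ge (bpoly star_poly).
have [M sIM] := sI c d; rewrite (sIM M.+1 _ _ (leqnSn M) Sd).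
rewrite big_ord_recl expr0 scale1r hasse0 lX0 mul1r.
rewrite addrAC [_ + _ - K _ a _]addrAC subrr add0r.
rewrite rpredB ?rpred_sum // => [k _|p _].
  by rewrite rpredZ // (in_ideal_null (in_ideal_hasseS _ lder_star_poly)).
rewrite rpred_sum // => k _; rewrite rpredZ //.
exact: in_ideal_null (star_poly_orthogonal k) _ _.
Qed.

End ZhuAlgebra.

Theorem mainTheorem4 (R : realType) (V : lmodType R[i]) (X : weakQVA V)
    (n : nat) :
  bilinear_for *:%R *:%R (star X n) /\
  two_sided_ideal (star X n) (Otilde X n) /\
  exists mul : Atilde X n -> Atilde X n -> Atilde X n,
    [/\ bilinear_for *:%R *:%R mul,
        forall u v : V,
          mul (Aproj X n u) (Aproj X n v) = Aproj X n (star X n u v)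
      & associative mul].
Proof.
have bil := star_bilinear X n; have ideal := star_ideal X n.
by split=> //; split=> //; apply: quotient_algebra => //; exact: star_assoc.
Qed.
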